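(* Let $n\ge 2$. For $2\le k\le n$ let $\beta_k=s_{k-1}s_{k-3}s_{k-5}\cdots$ be the product of one colour class of the bipartite $2$-colouring of the Coxeter diagram of $W_{J_k}$ (the class containing $s_{k-1}$), so that $\beta_{k-1}$ is the product of the other class (with $\beta_1=\mathbf 1$). Then: (a) $(\beta_2,\dots,\beta_n)$ is a tower; (b) its quotients $u_k=\beta_{k-1}\beta_k$ are the bipartite Coxeter elements $c_-c_+$ of $W_{J_k}$, i.e. the product of the two colour classes $c_-=\beta_{k-1}$ and $c_+=\beta_k$ of simple reflections of $W_{J_k}$; (c) every $\beta_k$ is an involution; (d) $\ell(\beta_k)=\lfloor k/2\rfloor$ for $2\le k\le n$; (e) $\Lambda=\sum_{k=2}^{n}\ell(\beta_k)=\lfloor n^2/4\rfloor$.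
   Context: Permutations in $S_n$ are multiplied as functions: $(\pi g)(i)=\pi(g(i))$. For $1\le k\le n$, $G_k=\mathrm{Sym}\{1,\dots,k\}$ is the subgroup of $S_n$ of permutations fixing each of $k+1,\dots,n$. A $k$-cycle on $\{1,\dots,k\}$ is an element of $G_k$ that is a single cycle of length $k$. A tower is a sequence $(g_2,\dots,g_n)$ with $g_k\in G_k\setminus G_{k-1}$ such that, setting $g_1:=\mathbf 1$, each $u_k:=g_{k-1}^{-1}g_k$ is a $k$-cycle on $\{1,\dots,k\}$ $(2\le k\le n)$. $s_i=(i\ \,i{+}1)$, $1\le i\le n-1$, are the simple reflections of $S_n=W(A_{n-1})$; $\ell$ is Coxeter length (number of inversions). $J_k=\{s_1,\dots,s_{k-1}\}$ and $W_{J_k}=G_k$ is the corresponding standard parabolic subgroup, whose Coxeter diagram is the path with nodes $s_1,\dots,s_{k-1}$. The product defining $\beta_k$ runs over $s_{k-1},s_{k-3},\dots$ down to $s_1$ or $s_2$ according to the parity of $k$. For a tower, $\Lambda=\sum_{k=2}^n\ell(g_k)$. *)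

(* Defs.v *)
From mathcomp Require Import all_boot all_fingroup.

Set Implicit Arguments.
Unset Strict Implicit.
Unset Printing Implicit Defensive.

Import GroupScope.

(* Permutations act on 'I_n, so the point i of {1, ..., n} is the ordinal i - 1;
   the indices of s_i, G_k, g_k, u_k, beta_k are nevertheless kept 1-based.     *)

(* MathComp's product on 'S_n composes from left to right, (s * t) i = t (s i);
   here (p \oS g) i = p (g i).                                                  *)
Definition pmul n (p g : 'S_n) : 'S_n := g * p.
Notation "p \oS g" := (pmul p g) (at level 40, left associativity).

Lemma pmulE n (p g : 'S_n) i : (p \oS g) i = p (g i).
Proof. exact: permM. Qed.

Definition G n k : {set 'S_n} := Sym [set i : 'I_n | i < k].

(* A k-cycle on {1, ..., k}: the remaining points are fixed and {1, ..., k} is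
   one of the orbits of g.                                                      *)
Definition kcycle n k (g : 'S_n) : Prop :=
  g \in G n k /\ [set i : 'I_n | i < k] \in porbits g.

(* A sequence (g_2, ..., g_n) is the restriction to 2 <= k <= n of a function on
   nat; whatever its other values, g_1 is taken to be the identity.             *)
Definition entry n (g : nat -> 'S_n) k : 'S_n := if k == 1%N then 1 else g k.

Definition tower_quot n (g : nat -> 'S_n) k : 'S_n :=
  (entry g k.-1)^-1 \oS entry g k.

Definition tower n (g : nat -> 'S_n) : Prop :=
  forall k, 2 <= k <= n ->
    g k \in G n k :\: G n k.-1 /\ kcycle k (tower_quot g k).

(* s_i = (i i+1), and 1 outside the range 1 <= i <= n - 1.                      *)
Definition sref n (i : nat) : 'S_n :=
  if (insub i.-1, insub i) is (Some a, Some b) then tperm a b else 1.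

Definition ell n (g : 'S_n) : nat :=
  #|[set p : 'I_n * 'I_n | (p.1 < p.2) && (g p.2 < g p.1)]|.

Definition Lambda n (g : nat -> 'S_n) : nat := \sum_(2 <= k < n.+1) ell (g k).

Definition J n k : {set 'S_n} := [set sref n i.+1 | i : 'I_k.-1].

(* Edges of the Coxeter diagram: m(s, t) >= 3, with m(s, t) the order of st.    *)
Definition coxeter_edge n (s t : 'S_n) : bool := 2 < #[s \oS t].

(* (Cm, Cp) are the colour classes of a proper 2-colouring of the Coxeter
   diagram with set of nodes S; a class may be empty.                           *)
Definition two_colouring n (S Cm Cp : {set 'S_n}) : Prop :=
  [/\ Cm :|: Cp = S, [disjoint Cm & Cp],
      {in Cm &, forall s t, ~~ coxeter_edge s t}
    & {in Cp &, forall s t, ~~ coxeter_edge s t}].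

(* c is the product of the elements of C, whatever the order of the factors.    *)
Definition class_product n (C : {set 'S_n}) (c : 'S_n) : Prop :=
  forall r : seq 'S_n, perm_eq r (enum C) -> c = \big[@pmul n/1]_(s <- r) s.

(* beta_k = s_(k-1) s_(k-3) s_(k-5) ..., down to s_1 or s_2.                    *)
Fixpoint beta n (k : nat) : 'S_n :=
  if k is j.+2 then sref n j.+1 \oS beta n j else 1.

(* Main.v *)
Require Import Defs.
From HB Require Import structures.
From mathcomp Require Import all_boot all_fingroup.
From mathcomp Require Import cyclic zify.

(** The whole statement rests on one closed formula.  On the points
    0, ..., k - 1 the permutation beta_k exchanges k - 1 with k - 2, then
    k - 3 with k - 4, and so on: a point at odd distance from k moves one step
    down, a point at even distance one step up ([beta_val]).  For odd k the
    point 0 is left over, and the truncated predecessor fixes it, so that the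
    formula needs no separate case.

    Three parts are read off this formula.  beta_k is an involution, moving
    k - 1; its inversions are exactly the pairs (j - 1, j) with 0 < j < k
    and k - j odd, and there are k %/ 2 of them ([ell_beta]); summing these
    numbers gives n ^ 2 %/ 4 ([sum_half]).

    For the tower, beta_(k-1) after beta_k moves points at odd distance from k
    down by two and the other points up by two, and reflects at the two ends.
    Starting from k - 1 it therefore runs down through one parity class and
    back up through the other, meeting every point below k before it returns
    ([quot_iter]); this is the required k-cycle ([kcycle_quot]).

    For the bipartite Coxeter elements, s_i and s_(i+1) do not commute and
    their product has order at least 3, while reflections whose indices have
    the same parity commute.  Hence a proper 2-colouring of the path s_1, ...,
    s_(k-1) must alternate, and it is determined by the class that contains
    s_(k-1) ([colouring_alternates]).  Both classes consist of commuting
    reflections, so their products do not depend on the order of the factors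
    ([pmul_perm_commute]) and are beta_k and beta_(k-1). *)

Set Implicit Arguments.
Unset Strict Implicit.
Unset Printing Implicit Defensive.

(** * Products of commuting permutations *)

Section Pmul.
Variable n : nat.
Implicit Types (p q : 'S_n) (r : seq 'S_n).

Lemma pmulA : associative (@pmul n).
Proof. by move=> p q s; rewrite /pmul mulgA. Qed.

Lemma pmul1l : left_id 1%g (@pmul n).
Proof. by move=> p; rewrite /pmul mulg1. Qed.

Lemma pmul1r : right_id 1%g (@pmul n).
Proof. by move=> p; rewrite /pmul mul1g. Qed.

HB.instance Definition _ :=
  Monoid.isLaw.Build 'S_n 1%g (@pmul n) pmulA pmul1l pmul1r.

Lemma pmul_commute_big p r :
  {in r, forall q, p \oS q = q \oS p} ->
  p \oS \big[@pmul n/1%g]_(s <- r) s = (\big[@pmul n/1%g]_(s <- r) s) \oS p.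
Proof.
elim: r => [|q r IHr] com; first by rewrite big_nil pmul1l pmul1r.
rewrite big_cons pmulA com ?mem_head // -!pmulA IHr // => s rs.
by rewrite com // inE rs orbT.
Qed.

Lemma pmul_perm_commute r1 r2 :
  {in r2 &, forall p q, p \oS q = q \oS p} -> perm_eq r1 r2 ->
  \big[@pmul n/1%g]_(s <- r1) s = \big[@pmul n/1%g]_(s <- r2) s.
Proof.
elim: r2 r1 => [|p r2 IHr] r1 com eqr.
  by rewrite (perm_nilP eqr).
have r1p : p \in r1 by rewrite (perm_mem eqr) mem_head.
case/splitPr: r1p eqr => l1 l2 eqr.
have eqr' : perm_eq (l1 ++ l2) r2.
  by rewrite -(perm_cons p) -(permPr eqr) (perm_catCA [:: p] l1 l2).
rewrite big_cons -(IHr _ _ eqr'); last first.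
  by move=> s t rs rt; apply: com; rewrite inE ?rs ?rt orbT.
rewrite !big_cat big_cons /= !pmulA (@pmul_commute_big p l1) // => q l1q.
apply: com; rewrite ?mem_head // inE.
by rewrite -(perm_mem eqr') mem_cat l1q orbT.
Qed.

End Pmul.

(** * Simple reflections *)

Lemma sref_val n i (x : 'I_n) : 0 < i < n ->
  sref n i x = (if x == i.-1 :> nat then i else if x == i :> nat then i.-1 else x)
    :> nat.
Proof.
move=> /andP[i0 ilt]; rewrite /sref.
case: insubP => [a _ va|]; last lia.
case: insubP => [b _ vb|]; last by rewrite ilt.
move: va vb => /= va vb.
case: tpermP => [->|->|/eqP xa /eqP xb]; last rewrite -!val_eqE /= in xa xb;
  by repeat case: ifP; lia.
Qed.

Lemma sref_inj n i j : 0 < i < n -> 0 < j < n -> sref n i = sref n j -> i = j.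
Proof.
move=> hi hj eqij.
have lti : i.-1 < n by lia.
have := sref_val (Ordinal lti) hi; rewrite eqij sref_val //= eqxx.
by repeat case: ifP; lia.
Qed.

Lemma srefK n i : 0 < i < n -> sref n i \oS sref n i = 1%g.
Proof.
move=> hi; apply/permP=> x; apply: val_inj.
rewrite pmulE perm1 /= !sref_val //=.
by repeat case: ifP; lia.
Qed.

(** Indices of the same parity are equal or at least two apart, and in the second
    case the reflections have disjoint supports. *)
Lemma sref_commute n i j : 0 < i < n -> 0 < j < n -> odd i = odd j ->
  sref n i \oS sref n j = sref n j \oS sref n i.
Proof.
move=> hi hj oij; apply/permP=> x; apply: val_inj.
rewrite !pmulE /= !sref_val //=.
by repeat case: ifP; lia.
Qed.

Lemma coxeter_nonedge n i j : 0 < i < n -> 0 < j < n -> odd i = odd j ->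
  ~~ coxeter_edge (sref n i) (sref n j).
Proof.
move=> hi hj oij; rewrite /coxeter_edge -leqNgt dvdn_leq // order_dvdn expgS expg1.
have -> : ((sref n i \oS sref n j) * (sref n i \oS sref n j))%g =
   (sref n i \oS sref n j) \oS (sref n i \oS sref n j) by [].
rewrite {2}sref_commute // pmulA -(pmulA (sref n i)) srefK // pmul1r srefK //.
Qed.

(** The square of s_i s_(i+1) sends i + 1 to i - 1 and then to i. *)
Lemma coxeter_edge_succ n i : 0 < i -> i.+1 < n ->
  coxeter_edge (sref n i) (sref n i.+1).
Proof.
move=> i0 ltin; rewrite /coxeter_edge ltnNge; apply/negP => le2.
have : ((sref n i \oS sref n i.+1) ^+ 2 = 1)%g.
  apply/eqP; rewrite -order_dvdn.
  by case: #[_]%g (order_gt0 (sref n i \oS sref n i.+1)) le2 => [|[|[|]]].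
move=> /permP/(_ (Ordinal ltin))/(congr1 val).
rewrite expgS expg1 permM perm1 !pmulE /= !sref_val /=; try lia.
by repeat case: ifP; lia.
Qed.

(** * The involutions beta_k *)

(** Induction by steps of two: the new factor s_(k-1) acts on the two points
    k - 2 and k - 1, which beta_(k-2) fixes. *)
Lemma beta_val n k (x : 'I_n) : k <= n ->
  beta n k x = (if x < k then if odd (k - x) then x.-1 else x.+1 else x) :> nat.
Proof.
elim/ltn_ind: k => -[|[|k]] IHk lekn /=; rewrite ?perm1 //.
  by case: ifP => //; case: (nat_of_ord x).
rewrite pmulE sref_val ?IHk //=; try lia.
by repeat case: ifP; lia.
Qed.

Lemma betaK n k : k <= n -> beta n k \oS beta n k = 1%g.
Proof.
move=> lekn; apply/permP=> x; apply: val_inj.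
rewrite pmulE perm1 /= !beta_val //.
by repeat case: ifP; lia.
Qed.

Lemma betaV n k : k <= n -> ((beta n k)^-1)%g = beta n k.
Proof. by move=> lekn; apply/eqP; rewrite eq_sym eq_mulgV1 invgK [(_ * _)%g]betaK. Qed.

(** beta_k moves the point k - 1, which G_(k-1) fixes. *)
Lemma beta_notin n k : 2 <= k <= n -> beta n k \notin G n k.-1.
Proof.
move=> hk; have ltk : k.-1 < n by lia.
rewrite inE; apply/negP => /subsetP/(_ (Ordinal ltk)).
rewrite !inE /= ltnn -val_eqE /= beta_val /=; last lia.
by repeat case: ifP; lia.
Qed.

Lemma beta_in n k : k <= n -> beta n k \in G n k.
Proof.
move=> lekn; rewrite inE; apply/subsetP => x.
by rewrite !inE -val_eqE /= beta_val //; case: ifP => //; rewrite eqxx.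
Qed.

Lemma order_beta n k : 2 <= k <= n -> #[beta n k]%g = 2.
Proof.
move=> hk; apply: nt_prime_order => //.
  by rewrite expgS expg1 [(_ * _)%g]betaK //; lia.
by apply: contraNneq (beta_notin hk) => ->; rewrite group1.
Qed.

(** * Lengths *)

Lemma ell_beta n k : 2 <= k <= n -> ell (beta n k) = k %/ 2.
Proof.
move=> hk; case: n hk => [|n] hk; first lia.
have lekn : k <= n.+1 by lia.
(* The m-th inversion, numbered from the top: the pair (k - 2m - 2, k - 2m - 1). *)
pose f (m : 'I_(k %/ 2)) : 'I_n.+1 * 'I_n.+1 :=
  (inord (k - m.*2.+2), inord (k - m.*2.+1)).
have f1 m : (f m).1 = k - m.*2.+2 :> nat.
  by rewrite inordK //; have := ltn_ord m; lia.
have f2 m : (f m).2 = k - m.*2.+1 :> nat.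
  by rewrite inordK //; have := ltn_ord m; lia.
have inj_f : injective f.
  move=> a b eq_ab; apply: val_inj; have := f2 a; rewrite eq_ab f2 /=.
  by have := ltn_ord a; have := ltn_ord b; lia.
rewrite -[RHS]card_ord -(card_imset _ inj_f); apply: eq_card => -[x y].
rewrite !inE /= !beta_val //; apply/idP/imsetP => [inv_xy | [m _ xy]]; last first.
  have := f1 m; have := f2 m; rewrite -xy /= => -> ->.
  by have := ltn_ord m; repeat case: ifP; lia.
have [ltyk oddy xy] : [/\ y < k, odd (k - y) & y = x.+1 :> nat].
  by move: inv_xy; repeat case: ifP; split; lia.
have ltm : (k - y) %/ 2 < k %/ 2 by lia.
exists (Ordinal ltm) => //.
apply/eqP; rewrite -pair_eqE /= -!val_eqE /= !inordK /=; lia.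
Qed.

(** Writing the upper bound as 2m or 2m + 1 removes both roundings, and the
    induction step becomes a polynomial identity in m. *)
Lemma sum_half n : \sum_(2 <= k < n.+1) k %/ 2 = n ^ 2 %/ 4.
Proof.
case: n => [|n]; first by rewrite big_geq.
elim: n => [|n IHn]; first by rewrite big_geq.
rewrite big_nat_recr //= IHn.
have := odd_double_half n; rewrite -muln2.
by case: (odd n) => /= <-; move: n./2 => m; rewrite !expnS !expn0; nia.
Qed.

(** * The quotients are cycles *)

Lemma tower_quot_beta n k : 2 <= k <= n ->
  tower_quot (beta n) k = beta n k.-1 \oS beta n k.
Proof.
move=> hk; rewrite /tower_quot /entry (_ : k == 1 = false); last lia.
case: eqP => [->|_]; first by rewrite invg1.
by rewrite betaV //; lia.
Qed.

(** The path followed by k - 1: down by two until the bottom, then up through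
    the points of the other parity. *)
Lemma quot_iter n k (x : 'I_n) m : 2 <= k <= n -> x = k.-1 :> nat -> m < k ->
  ((beta n k.-1 \oS beta n k) ^+ m)%g x =
    (if m.*2 < k then k - m.*2.+1 else m.*2 - k) :> nat.
Proof.
move=> hk xk; elim: m => [|m IHm] ltmk.
  by rewrite expg0 perm1 xk; case: ifP; lia.
rewrite expgSr permM pmulE !beta_val; try lia.
rewrite IHm; last lia.
by repeat case: ifP; lia.
Qed.

Lemma kcycle_quot n k : 2 <= k <= n -> kcycle k (beta n k.-1 \oS beta n k).
Proof.
move=> hk; set u := _ \oS _.
have uval (y : 'I_n) : (u y < k) = (y < k).
  by rewrite pmulE !beta_val; try lia; repeat case: ifP; lia.
split.
  rewrite inE; apply/subsetP => y; rewrite !inE; apply: contraR => leky.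
  apply/eqP/val_inj; rewrite /= pmulE !beta_val; try lia.
  by repeat case: ifP; lia.
have ltk : k.-1 < n by lia.
apply/imsetP; exists (Ordinal ltk) => //; apply/setP => y.
rewrite inE; apply/idP/porbitP => [ltyk | [m ->]]; last first.
  elim: m => [|m IHm]; first by rewrite expg0 perm1 /=; lia.
  by rewrite expgSr permM uval.
(* Odd distances are met on the way down, even ones on the way back up. *)
exists (if odd (k - y) then (k - y) %/ 2 else (k + y) %/ 2).
apply: val_inj; rewrite /= quot_iter //; last by case: ifP; lia.
by repeat case: ifP; lia.
Qed.

(** * Bipartite colourings *)

(** The factors of beta_k, listed in the order of its defining product. *)
Fixpoint colour_class n k : seq 'S_n :=
  if k is j.+2 then sref n j.+1 :: colour_class n j else [::].

Lemma beta_big n k : beta n k = \big[@pmul n/1%g]_(s <- colour_class n k) s.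
Proof.
elim/ltn_ind: k => -[|[|k]] IHk; rewrite ?big_nil //=.
by rewrite big_cons IHk.
Qed.

Lemma colour_classP n k s :
  reflect (exists2 i, 0 < i < k & odd (k - i) /\ s = sref n i)
          (s \in colour_class n k).
Proof.
elim/ltn_ind: k s => -[|[|k]] IHk s /=.
- by right=> -[i]; lia.
- by right=> -[i]; lia.
have {}IHk := IHk k (leqW (leqnn _)).
rewrite inE; apply: (iffP orP) => [[/eqP->|/IHk]|[i hi [oi ->]]].
- by exists k.+1; [lia|split=> //; lia].
- by case=> i hi [oi ->]; exists i; [lia|split=> //; lia].
have [->|ne] := eqVneq i k.+1; [by left|right].
by apply/IHk; exists i; [lia|split=> //; lia].
Qed.

Lemma colour_class_uniq n k : k <= n -> uniq (colour_class n k).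
Proof.
elim/ltn_ind: k => -[|[|k]] IHk lekn //=.
rewrite IHk ?andbT //; try lia.
by apply/negP=> /colour_classP[i hi [_ /sref_inj]]; lia.
Qed.

Lemma colour_class_commute n k : k <= n ->
  {in colour_class n k &, forall s t, s \oS t = t \oS s}.
Proof.
move=> lekn s t /colour_classP[i hi [oi ->]] /colour_classP[j hj [oj ->]].
by apply: sref_commute; lia.
Qed.

(** The recursion defining beta_k multiplies one particular enumeration of the
    colour class; commutation transfers the result to every enumeration. *)
Lemma class_product_beta n k (C : {set 'S_n}) : k <= n ->
  C =i colour_class n k -> class_product C (beta n k).
Proof.
move=> lekn eqC r eqr; rewrite beta_big; apply/esym/pmul_perm_commute.
  exact: colour_class_commute.
rewrite (permPl eqr); apply: uniq_perm; rewrite ?enum_uniq ?colour_class_uniq //.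
by move=> s; rewrite mem_enum eqC.
Qed.

Lemma mem_J n k s :
  reflect (exists2 i, 0 < i < k & s = sref n i) (s \in J n k).
Proof.
apply: (iffP imsetP) => [[i _ ->]|[i hi ->]].
  by exists i.+1 => //; have := ltn_ord i; lia.
have lti : i.-1 < k.-1 by lia.
by exists (Ordinal lti) => //=; rewrite prednK //; lia.
Qed.

Lemma mem_colour_class n k i : k <= n -> 0 < i < n ->
  (sref n i \in colour_class n k) = (i < k) && odd (k - i).
Proof.
move=> lekn hi; apply/colour_classP/andP => [[j hj [oj /sref_inj eqij]]|[lti oi]].
  by rewrite eqij; lia.
by exists i; [lia|].
Qed.

Lemma two_colouring_class n k : 2 <= k <= n ->
  two_colouring (J n k) [set s in colour_class n k.-1] [set s in colour_class n k].
Proof.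
move=> hk; split.
- apply/setP => s; rewrite !inE; apply/orP/mem_J.
    by case=> /colour_classP[i hi [oi ->]]; exists i => //; lia.
  case=> i hi ->; rewrite !mem_colour_class; lia.
- rewrite -setI_eq0; apply/eqP/setP => s; rewrite !inE; apply/negP => /andP[].
  by move=> /colour_classP[i hi [oi ->]]; rewrite mem_colour_class; lia.
- move=> s t; rewrite !inE => /colour_classP[i hi [oi ->]] /colour_classP[j hj [oj ->]].
  by apply: coxeter_nonedge; lia.
move=> s t; rewrite !inE => /colour_classP[i hi [oi ->]] /colour_classP[j hj [oj ->]].
by apply: coxeter_nonedge; lia.
Qed.

(** Consecutive reflections are joined by an edge, so the colour changes at
    every step along the path, starting from s_(k-1). *)
Lemma colouring_alternates n k (Cm Cp : {set 'S_n}) i : 2 <= k <= n ->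
  two_colouring (J n k) Cm Cp -> sref n k.-1 \in Cp -> 0 < i < k ->
  (sref n i \in Cp) = odd (k - i) /\ (sref n i \in Cm) = ~~ odd (k - i).
Proof.
move=> hk [cover disj indm indp] topP hi.
have xorC j : 0 < j < k -> (sref n j \in Cm) = (sref n j \notin Cp).
  move=> hj; have : sref n j \in Cm :|: Cp by rewrite cover; apply/mem_J; exists j.
  rewrite inE; have /disjointFr := disj => /(_ (sref n j)).
  by case: (sref n j \in Cm) => /= [->|_ ->].
have step j : 0 < j -> j.+1 < k -> (sref n j \in Cp) = (sref n j.+1 \notin Cp).
  move=> j0 ltj; have edge : coxeter_edge (sref n j) (sref n j.+1).
    by apply: coxeter_edge_succ; lia.
  have := indp (sref n j) (sref n j.+1); have := indm (sref n j) (sref n j.+1).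
  by rewrite edge !xorC; lia.
have inP d : forall j, 0 < j < k -> k.-1 - j = d -> (sref n j \in Cp) = odd (k - j).
  elim: d => [|d IHd] j hj eqd.
    have -> : j = k.-1 by lia.
    by rewrite topP; lia.
  by rewrite step ?(IHd j.+1); lia.
by rewrite xorC // (inP _ _ hi erefl).
Qed.

Lemma colouring_classes n k (Cm Cp : {set 'S_n}) : 2 <= k <= n ->
  two_colouring (J n k) Cm Cp -> sref n k.-1 \in Cp ->
  Cm =i colour_class n k.-1 /\ Cp =i colour_class n k.
Proof.
move=> hk col topP.
have alt i hi := @colouring_alternates n k Cm Cp i hk col topP hi.
have subJ s : (s \in Cm) || (s \in Cp) -> s \in J n k.
  by case: col => <- _ _ _; rewrite inE.
split=> s; apply/idP/colour_classP => [Cs | [i hi [oi ->]]].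
- have /mem_J[i hi eqs] := subJ s (introT orP (or_introl Cs)).
  move: Cs; rewrite eqs (alt i hi).2 => oi.
  have neq : i <> k.-1 by move=> eqi; move: oi; rewrite eqi; lia.
  by exists i; [lia|split=> //; lia].
- by rewrite (alt i _).2; lia.
- have /mem_J[i hi eqs] := subJ s (introT orP (or_intror Cs)).
  by move: Cs; rewrite eqs (alt i hi).1 => oi; exists i.
by rewrite (alt i _).1.
Qed.

(** * The tower of bipartite involutions *)

Theorem theorem7p2 (n : nat) (hn : 2 <= n) :
  [/\ (* (a) *)
      tower (beta n),
      (* (b) *)
      (forall k, 2 <= k <= n ->
         [/\ tower_quot (beta n) k = beta n k.-1 \oS beta n k,
             (exists Cm Cp : {set 'S_n},
                two_colouring (J n k) Cm Cp /\ sref n k.-1 \in Cp)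
           & (forall Cm Cp : {set 'S_n},
                two_colouring (J n k) Cm Cp -> sref n k.-1 \in Cp ->
                class_product Cm (beta n k.-1) /\ class_product Cp (beta n k))]),
      (* (c) *)
      (forall k, 2 <= k <= n -> #[beta n k]%g = 2),
      (* (d) *)
      (forall k, 2 <= k <= n -> ell (beta n k) = k %/ 2)
    & (* (e) *)
      Lambda (beta n) = n ^ 2 %/ 4].
Proof.
split.
- move=> k hk; split; last by rewrite tower_quot_beta //; apply: kcycle_quot.
  by rewrite inE beta_notin // beta_in //; lia.
- move=> k hk; split; first exact: tower_quot_beta.
    exists [set s in colour_class n k.-1], [set s in colour_class n k].
    split; first exact: two_colouring_class.
    by rewrite inE mem_colour_class; lia.
  move=> Cm Cp col topP; have [eqm eqp] := colouring_classes hk col topP.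
  by split; apply: class_product_beta => //; lia.
- by move=> k; apply: order_beta.
- by move=> k; apply: ell_beta.
rewrite /Lambda -sum_half; apply: eq_big_nat => k hk.
by apply: ell_beta; lia.
Qed.
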